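(* Let $G$ be a graph with minimum degree $\delta$ and maximum cut $\beta$. Then \[\alpha_{ir}(G) \leq \frac{-2 \delta +1 + \sqrt{(2 \delta -1)^2 +8\beta}}{2}.\] Moreover, the bound is sharp: there exist graphs for which equality holds.
   Context: All graphs are finite, simple, undirected and have at least one vertex. An irregular independent set of a graph $G$ is an independent set $A$ of $G$ such that any two distinct vertices in $A$ have different degrees in $G$. The irregular independence number $\alpha_{ir}(G)$ is the size of a largest irregular independent set of $G$. For $A \subseteq V(G)$, $e(A, V(G)\setminus A)$ is the number of edges of $G$ with one vertex in $A$ and the other in $V(G) \setminus A$. The maximum cut of $G$ is $\beta = \beta(G) = \max\{e(A, V(G)\setminus A) : A \subseteq V(G)\}$. *)

(* Defs.v *)
From mathcomp Require Import all_boot all_order all_algebra.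

Set Implicit Arguments.
Unset Strict Implicit.
Unset Printing Implicit Defensive.

Record sgraph := SGraph {
  vertex :> finType;
  adj : rel vertex;
  adj_sym : symmetric adj;
  adj_irrefl : irreflexive adj;
  vertex_gt0 : 0 < #|vertex|
}.

Section Invariants.
Variable G : sgraph.
Implicit Types (x y : G) (A : {set G}).

Definition deg x : nat := #|[set y | adj x y]|.

(* Degrees are smaller than #|G| and G is nonempty, so the default value #|G|
   never survives in the minimum. *)
Definition min_degree : nat := \big[minn/#|G|]_(x : G) deg x.

Definition independent A : bool :=
  [forall x in A, forall y in A, ~~ adj x y].

Definition irregular_independent A : bool :=
  independent A && [forall x in A, forall y in A, (x != y) ==> (deg x != deg y)].

Definition alpha_ir : nat := \max_(A : {set G} | irregular_independent A) #|A|.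

(* An edge crossing the cut is the ordered pair (endpoint in A, endpoint
   outside A), so each such edge is counted exactly once. *)
Definition cut_size A : nat :=
  #|[set p : G * G | [&& p.1 \in A, p.2 \notin A & adj p.1 p.2]]|.

Definition max_cut : nat := \max_(A : {set G}) cut_size A.

End Invariants.

(* Main.v *)
Require Import Defs.
From mathcomp Require Import all_boot all_order all_algebra.
From mathcomp Require Import zify ring lra.

(** Let [A] be a largest irregular independent set and [a = #|A|]. Every edge
    with an endpoint in [A] leaves [A], so the cut of [A] is the sum of the
    degrees over [A]. These degrees are distinct and at least [delta], hence
    [a * delta + 'C(a, 2) <= beta]; completing the square gives the bound.
    Equality holds for the complete graph on two vertices. *)

Set Implicit Arguments.
Unset Strict Implicit.
Unset Printing Implicit Defensive.

Import Order.TTheory GRing.Theory Num.Theory.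

(** Induction on [#|A|] with [m] general: once a minimiser of [f] is removed, injectivity forces the
    remaining values to be at least [m.+1]. The extra unit for each remaining element turns
    ['C(n, 2)] into ['C(n.+1, 2)] by Pascal's rule. *)
Lemma leq_sum_inj_geq (T : finType) (f : T -> nat) (m : nat) (A : {set T}) :
    {in A &, injective f} -> {in A, forall x, m <= f x} ->
  #|A| * m + 'C(#|A|, 2) <= \sum_(x in A) f x.
Proof.
elim: {A}#|A| {-2}A m (erefl #|A|) => [|n IHn] A m cardA f_inj f_ge.
  by rewrite cardA.
have /card_gt0P[x0 Ax0] : 0 < #|A| by rewrite cardA.
case: (@arg_minnP _ x0 (fun x => x \in A) f Ax0) => x Ax x_min.
have cardAx : #|A :\ x| = n by have := cardsD1 x A; rewrite Ax cardA; case.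
have := IHn (A :\ x) m.+1 cardAx.
rewrite (big_setD1 x Ax) cardA cardAx binS bin1 /=.
have f_inj' : {in A :\ x &, injective f}.
  by move=> y z /setD1P[_ Ay] /setD1P[_ Az]; apply: f_inj.
have f_ge' : {in A :\ x, forall y, m.+1 <= f y}.
  move=> y /setD1P[yx Ay]; apply: leq_ltn_trans (f_ge x Ax) _.
  rewrite ltn_neqAle x_min // andbT.
  by apply: contra yx => /eqP fxy; apply/eqP/f_inj.
move=> /(_ f_inj' f_ge') {IHn}.
have := f_ge x Ax.
nia.
Qed.

Section Bounds.
Variable G : sgraph.
Implicit Types (x : G) (A : {set G}).

Lemma min_degree_leq x : min_degree G <= deg x.
Proof.
rewrite /min_degree; elim: (index_enum G) (mem_index_enum x) => // y s IHs.
rewrite in_cons big_cons geq_min => /predU1P[->|/IHs->]; first by rewrite leqnn.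
by rewrite orbT.
Qed.

Lemma cut_size_leq_max A : cut_size A <= max_cut G.
Proof. exact: (@leq_bigmax _ (fun A => cut_size A)). Qed.

Lemma cut_size_independent A :
  independent A -> cut_size A = \sum_(x in A) deg x.
Proof.
move=> /forall_inP indA; rewrite /cut_size -sum1dep_card.
under [RHS]eq_bigr do rewrite /deg -sum1dep_card.
rewrite pair_big_dep; apply: eq_bigl => -[x y] /=.
case Ax: (x \in A) => //=.
(* A neighbour of [x] inside [A] would contradict independence, so requiring the second endpoint to
   lie outside [A] excludes no edge. *)
have [Ay|//] := boolP (y \in A).
by have /forall_inP/(_ y Ay)/negbTE-> := indA x Ax.
Qed.

Lemma irregular_independent_max_cut A :
  irregular_independent A ->
  #|A| * min_degree G + 'C(#|A|, 2) <= max_cut G.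
Proof.
case/andP=> indA /forall_inP irrA; apply: leq_trans (cut_size_leq_max A).
rewrite (cut_size_independent indA); apply: leq_sum_inj_geq.
  move=> x y Ax Ay exy; apply/eqP; apply: contraLR isT => xy.
  by have /forall_inP/(_ y Ay) := irrA x Ax; rewrite xy exy eqxx.
by move=> x _; apply: min_degree_leq.
Qed.

Lemma alpha_ir_max_cut :
  alpha_ir G * min_degree G + 'C(alpha_ir G, 2) <= max_cut G.
Proof.
(* The empty set makes the family nonempty, so the maximum is attained by some [A]. *)
rewrite /alpha_ir; have irr0 : irregular_independent (set0 : {set G}).
  by apply/andP; split; apply/forall_inP => x; rewrite inE.
have [|A irrA ->] := @eq_bigmax_cond _ (@irregular_independent G) (fun A => #|A|).
  by apply/card_gt0P; exists set0.
exact: irregular_independent_max_cut.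
Qed.

Lemma alpha_ir_gt0 : 0 < alpha_ir G.
Proof.
have /card_gt0P[x _] := vertex_gt0 G.
rewrite -(cards1 x); apply: (@leq_bigmax_cond _ _ (fun A => #|A|) [set x]).
apply/andP; split; apply/forall_inP => y /set1P->; apply/forall_inP => z /set1P->.
  by rewrite adj_irrefl.
by rewrite eqxx.
Qed.

End Bounds.

Lemma neq_sym_rel (T : eqType) : symmetric (fun x y : T => x != y).
Proof. by move=> x y; rewrite eq_sym. Qed.

Lemma neq_irrefl_rel (T : eqType) : irreflexive (fun x y : T => x != y).
Proof. by move=> x; rewrite eqxx. Qed.

Lemma card_bool_gt0 : 0 < #|{: bool}|.
Proof. by rewrite card_bool. Qed.

Definition K2 : sgraph :=
  SGraph (@neq_sym_rel bool) (@neq_irrefl_rel bool) card_bool_gt0.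

Lemma deg_K2 (x : K2) : deg x = 1.
Proof.
rewrite /deg -[RHS](cards1 (~~ x : K2)); congr #|pred_of_set _|.
by apply/setP => y; rewrite !inE /=; case: x y => [] [].
Qed.

Lemma min_degree_K2 : min_degree K2 = 1.
Proof.
apply/eqP; rewrite eqn_leq -{1}(deg_K2 (true : K2)) min_degree_leq /=.
(* Positivity holds for the default value [#|K2|] and for every degree, and [minn] preserves it. *)
rewrite /min_degree; elim/big_ind: _ => [|m n m_gt0 n_gt0|x _].
- exact: vertex_gt0.
- by rewrite leq_min m_gt0.
- by rewrite deg_K2.
Qed.

Lemma max_cut_K2 : max_cut K2 <= 1.
Proof.
apply/bigmax_leqP => A _; rewrite /cut_size.
(* The two orientations of the only edge cannot both cross: they put [true] on opposite sides of the
   cut. *)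
apply/card_le1_eqP => -[x y] [z t]; rewrite !inE /=.
by case: x y z t => [] [] [] [] //=;
  case: (true \in A); case: (false \in A).
Qed.

(** With minimum degree 1 and maximum cut at most 1, the general inequality leaves no room for a
    value above 1. *)
Lemma alpha_ir_K2 : alpha_ir K2 = 1.
Proof.
have := alpha_ir_max_cut K2; have := alpha_ir_gt0 K2; have := max_cut_K2.
rewrite min_degree_K2; lia.
Qed.

Local Open Scope ring_scope.

Theorem theorem2p2 (R : rcfType) :
  (forall G : sgraph,
     (alpha_ir G)%:R <=
       (- 2 * (min_degree G)%:R + 1 +
        Num.sqrt ((2 * (min_degree G)%:R - 1) ^+ 2 + 8 * (max_cut G)%:R)) / 2
       :> R)
  /\
  (exists G : sgraph,
     (alpha_ir G)%:R =
       (- 2 * (min_degree G)%:R + 1 +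
        Num.sqrt ((2 * (min_degree G)%:R - 1) ^+ 2 + 8 * (max_cut G)%:R)) / 2
       :> R).
Proof.
split=> [G|].
  have := alpha_ir_max_cut G.
  set a := alpha_ir G; set d := min_degree G; set b := max_cut G => le_b.
  (* Doubling replaces ['C(a, 2)] by [a * a - a]; moving [a] to the right avoids truncated
     subtraction before the cast to [R]. *)
  have le2b : (2 * (a * d) + a * a <= 2 * b + a)%N.
    by have := mul_bin_diag a 1; rewrite bin1; nia.
  move: le2b; rewrite -(ler_nat R) !natrD !natrM => le2b.
  suff : 2 * a%:R + (2 * d%:R - 1) <=
         Num.sqrt ((2 * d%:R - 1) ^+ 2 + 8 * b%:R) :> R by lra.
  (* Passing to the absolute value allows squaring without a sign condition; the squares differ by
     four times the two sides of [le2b]. *)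
  apply: le_trans (ler_norm _) _.
  rewrite -sqrtr_sqr ler_wsqrtr //; nra.
exists K2; rewrite alpha_ir_K2 min_degree_K2.
have -> : max_cut K2 = 1%N.
  apply/eqP; rewrite eqn_leq max_cut_K2.
  by have := alpha_ir_max_cut K2; rewrite alpha_ir_K2 min_degree_K2.
(* The root is 3, so the bound is [(- 2 + 1 + 3) / 2 = 1]. *)
have -> : (2 * 1 - 1) ^+ 2 + 8 * 1 = 3 ^+ 2 :> R by ring.
rewrite sqrtr_sqr ger0_norm //; lra.
Qed.
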